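(* Let $A$ be a finite-dimensional Jordan algebra over $\mathbb{R}$ with identity. Then the following statements are equivalent: (1) $A$ has no nilpotent elements; (2) $A$ is a Baer Jordan algebra.
   Context: For a Jordan algebra $A$ put $A_+=\{a^2: a\in A\}$, $U_a b=2(ab)a-a^2b$ and $U_a(A)=\{U_ax : x\in A\}$ for $a,b\in A$. For a subset $S\subseteq A$ put $S^\perp=\{a\in A: U_a x=0 \text{ for all } x\in S\}$. An idempotent is an element $e$ with $e^2=e$. $A$ is called a Baer Jordan algebra if for every subset $S\subseteq A_+$ there exists an idempotent $e\in A$ such that $S^\perp=U_e(A)$. ''No nilpotent elements'' means that $0$ is the only element $a$ with $a^n=0$ for some $n\ge 1$. *)

(* Defs.v *)
From HB Require Import structures.
From mathcomp Require Import all_boot all_order all_algebra.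
From mathcomp Require Import boolp classical_sets functions reals.

Set Implicit Arguments.
Unset Strict Implicit.
Unset Printing Implicit Defensive.

Import GRing.Theory.
Local Open Scope classical_set_scope.
Local Open Scope ring_scope.

(* The product is not assumed to be associative: it is an arbitrary bilinear
   map [mul] on the module [A], whose type carries only the linear structure. *)
Record is_jordan (F : fieldType) (A : lmodType F)
    (mul : {bilinear A -> A -> A}) : Prop := IsJordan {
  jordan_mulC : forall a b, mul a b = mul b a;
  jordan_identity : forall a b,
    mul (mul (mul a a) b) a = mul (mul a a) (mul b a)
}.

Definition is_identity (F : fieldType) (A : lmodType F)
    (mul : {bilinear A -> A -> A}) (u : A) : Prop :=
  forall a, mul u a = a /\ mul a u = a.

Definition idempotent_elt (F : fieldType) (A : lmodType F)
    (mul : {bilinear A -> A -> A}) (e : A) : Prop := mul e e = e.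

(* a^1 = a and a^(n+1) = a * a^n; only meaningful for n >= 1. *)
Definition jpow (F : fieldType) (A : lmodType F)
    (mul : {bilinear A -> A -> A}) (a : A) (n : nat) : A :=
  iter n.-1 (mul a) a.

Definition no_nilpotent_elements (F : fieldType) (A : lmodType F)
    (mul : {bilinear A -> A -> A}) : Prop :=
  forall a n, (1 <= n)%N -> jpow mul a n = 0 -> a = 0.

Definition squares (F : fieldType) (A : lmodType F)
    (mul : {bilinear A -> A -> A}) : set A := [set mul a a | a in setT].

Definition Uop (F : fieldType) (A : lmodType F)
    (mul : {bilinear A -> A -> A}) (a b : A) : A :=
  2%:R *: mul (mul a b) a - mul (mul a a) b.

(* S ranges over the argument of U, the element of the annihilator is its index. *)
Definition jperp (F : fieldType) (A : lmodType F)
    (mul : {bilinear A -> A -> A}) (S : set A) : set A :=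
  [set a | forall x, S x -> Uop mul a x = 0].

Definition is_baer_jordan (F : fieldType) (A : lmodType F)
    (mul : {bilinear A -> A -> A}) : Prop :=
  is_jordan mul /\
  forall S : set A, S `<=` squares mul ->
    exists2 e : A, idempotent_elt mul e & jperp mul S = range (Uop mul e).

(* Main.v *)
(** A Baer Jordan algebra with unit [u] has no nonzero [a] with [a^2 = 0]: the
    elements of square zero form the annihilator of [u], which is [U_e(A)] for an
    idempotent [e]; as [e] lies in [U_e(A)], [e = e^2 = 0].

    Conversely, let [A] be finite-dimensional without nilpotents. From
    [(U_b c)^2 = U_b U_c b^2], the relation [U_a b^2 = 0] gives [U_b a = 0] and
    [U_b a^2 = 0], hence [(ab)^2 = 0], [ab = 0] and [b^2 a = 0]. So [a] is killed by
    all powers of [b]. These span a commutative associative algebra with a unit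
    [r], the support of [b], and the annihilator of [b^2] is the Peirce 0-space of
    [r]. An annihilator is thus an intersection [B] of Peirce 0-spaces, a
    subalgebra; a maximal idempotent [e] of [B] is its unit, and [B = U_e(A)]. *)

Require Import Defs.
From HB Require Import structures.
From mathcomp Require Import all_boot all_order all_algebra.
From mathcomp Require Import boolp classical_sets functions reals.
From mathcomp Require Import lra.

Set Implicit Arguments.
Unset Strict Implicit.
Unset Printing Implicit Defensive.

Import Order.TTheory GRing.Theory Num.Theory.
Local Open Scope ring_scope.

(** * Linearized Jordan identities and the operators U *)

Section Jordan.
Variables (F : realFieldType) (A : vectType F) (mul : {bilinear A -> A -> A}).
Hypothesis jordan : is_jordan mul.

Local Notation "x ** y" := (mul x y) (at level 40, left associativity).
Local Notation U := (Uop mul).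
Local Notation coordA i := (coord (vbasis {:A}) i).

Let mulC x y : x ** y = y ** x.
Proof. exact: jordan_mulC. Qed.

Lemma coordA_inj (x y : A) : (forall i, coordA i x = coordA i y) -> x = y.
Proof.
move=> eq_xy; rewrite (coord_vbasis (memvf x)) (coord_vbasis (memvf y)).
by apply: eq_bigr => i _; rewrite eq_xy.
Qed.

Let mulDl x y z : (x + y) ** z = x ** z + y ** z. Proof. exact: linearDl. Qed.
Let mulDr x y z : x ** (y + z) = x ** y + x ** z. Proof. exact: linearDr. Qed.
Let mulNl x z : (- x) ** z = - (x ** z). Proof. exact: linearNl. Qed.
Let mulNr x z : x ** (- z) = - (x ** z). Proof. exact: linearNr. Qed.
Let mulZl k x z : (k *: x) ** z = k *: (x ** z). Proof. exact: linearZl_LR. Qed.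
Let mulZr k x z : x ** (k *: z) = k *: (x ** z). Proof. exact: linearZr_LR. Qed.
Let mul0l x : 0 ** x = 0. Proof. exact: linear0l. Qed.
Let mul0r x : x ** 0 = 0. Proof. exact: linear0r. Qed.
Let cD i (x y : A) : coordA i (x + y) = coordA i x + coordA i y.
Proof. exact: linearD. Qed.
Let cN i (x : A) : coordA i (- x) = - coordA i x. Proof. exact: linearN. Qed.
Let cZ i k (x : A) : coordA i (k *: x) = k * coordA i x. Proof. exact: linearZ. Qed.
Let c0 i : coordA i (0 : A) = 0. Proof. exact: linear0. Qed.
Let expand := (mulDl, mulDr, mulNl, mulNr, mulZl, mulZr, mul0l, mul0r,
  cD, cN, cZ, c0).

(** Makes the two orders of a commuting product a single atom for [lra]. *)
Local Ltac orient_products :=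
  repeat match goal with |- context [@Bilinear.sort _ _ _ _ _ _ mul ?x ?y] =>
    match goal with |- context [@Bilinear.sort _ _ _ _ _ _ mul y x] =>
      tryif constr_eq x y then fail else rewrite (mulC x y)
    end
  end.

(* Read coordinatewise, a linear relation between products is a linear relation
   between scalar unknowns. *)
Local Ltac linear_combination :=
  intros; apply: coordA_inj; let i := fresh "i" in intro i;
  repeat match goal with H : _ = _ |- _ =>
    apply (f_equal (fun v : A => coordA i v)) in H; cbv beta in H;
    rewrite ?expand in H; revert H
  end;
  rewrite ?expand; orient_products;
  (* Otherwise [lra] compares its atoms by unfolding them. *)
  repeat match goal with |- context [@coord ?K ?V ?n ?X i ?v] =>
    generalize (@coord K V n X i v); intro
  end; intros; lra.

(** In [J (x + y)] minus [J (x - y)] only terms odd in [y] survive, and [J y] removes the cubic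
    one. *)
Lemma jordan_linearized2 x y w :
  (x ** x) ** (w ** y) + 2%:R *: ((x ** y) ** (w ** x)) =
  ((x ** x) ** w) ** y + 2%:R *: (((x ** y) ** w) ** x).
Proof.
have J a : ((a ** a) ** w) ** a = (a ** a) ** (w ** a) by exact: jordan_identity.
move: (J (x + y)) (J (x - y)) (J y).
linear_combination.
Qed.

Lemma jordan_linearized x y z w :
  (x ** y) ** (w ** z) + (y ** z) ** (w ** x) + (z ** x) ** (w ** y) =
  ((x ** y) ** w) ** z + ((y ** z) ** w) ** x + ((z ** x) ** w) ** y.
Proof.
move: (jordan_linearized2 (x + y) z w) (jordan_linearized2 x z w)
  (jordan_linearized2 y z w).
linear_combination.
Qed.


Local Notation J := jordan_linearized.

Let UE a b : U a b = 2%:R *: ((a ** b) ** a) - (a ** a) ** b.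
Proof. by []. Qed.

Lemma sqr_mul a b :
  4%:R *: ((a ** b) ** (a ** b)) =
  2%:R *: (a ** U b a) + U a (b ** b) + U b (a ** a).
Proof.
rewrite !UE; move: (J a a b b).
linear_combination.
Qed.

Lemma Uop_sqr a b : U (a ** a) b = U a (U a b).
Proof.
rewrite !UE.
move: (J a a (b ** a) a) (J a a a (b ** a)) (congr1 (mul a) (J a a a b))
  (J a a b (a ** a)).
linear_combination.
Qed.

(* The relations below were found by linear algebra in the bidegree (4, 2) part of
   the free commutative algebra on [a] and [b]. *)
Lemma sqr_Uop a b : U a b ** U a b = U a (U b (a ** a)).
Proof.
rewrite !UE; move: (J a a (b ** a) (b ** a))
  (congr1 (mul (b ** a)) (J a a a b))
  (J b (a ** a) (b ** a) a)
  (J a a ((b ** a) ** b) a)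
  (J a a ((a ** a) ** b) b)
  (congr1 (mul a) (J a a b (b ** a)))
  (congr1 (mul a) (congr1 (mul b) (J a a a b)))
  (J a b ((a ** a) ** b) a)
  (congr1 (mul b) (congr1 (mul a) (J a a a b)))
  (congr1 (mul a) (congr1 (mul a) (J a a b b)))
  (congr1 (mul (a ** a)) (J a a b b))
  (J a a a ((b ** a) ** b)).
linear_combination.
Qed.

(** * Powers of one element *)

Local Notation pow a n := (iter n (mul a) a).

(** For [w] a power of [a], this is a recursion for the multiplications by powers of [a], starting
    from those by [a] and [a ** a]. *)
Lemma mul_mul2 a w z :
  (a ** (a ** w)) ** z = 2%:R *: ((a ** w) ** (a ** z)) + (a ** a) ** (w ** z)
    - a ** (a ** (w ** z)) - w ** (a ** (a ** z)).
Proof. by move: (J a w z a); linear_combination. Qed.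

Lemma comm_pow (g : {linear A -> A}) a :
    (forall z, g (a ** z) = a ** g z) ->
    (forall z, g ((a ** a) ** z) = (a ** a) ** g z) ->
  forall n z, g (pow a n ** z) = pow a n ** g z.
Proof.
move=> ga gaa n.
(* The recursion reaches two powers back. *)
suff [] : (forall z, g (pow a n ** z) = pow a n ** g z) /\
          (forall z, g (pow a n.+1 ** z) = pow a n.+1 ** g z) by [].
elim: n => [//|n [IHn IHn1]]; split=> // z.
have -> v : pow a n.+2 ** v = (a ** (a ** pow a n)) ** v by [].
rewrite !mul_mul2 !(linearB, linearD, linearZ) /=.
by rewrite -[a ** pow a n]/(pow a n.+1) !(ga, gaa, IHn, IHn1).
Qed.

Lemma mul_sqrC a z : a ** ((a ** a) ** z) = (a ** a) ** (a ** z).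
Proof. by move: (J a a a z); linear_combination. Qed.

Lemma mul_powC a n z : a ** (pow a n ** z) = pow a n ** (a ** z).
Proof. by apply: (comm_pow (g := mul a)) => // y; apply: mul_sqrC. Qed.

Lemma mul_pow a m n : pow a m ** pow a n = pow a (m + n).+1.
Proof.
elim: n => [|n IHn]; first by rewrite addn0 mulC.
by rewrite -[pow a n.+1]/(a ** pow a n) -mul_powC IHn addnS.
Qed.

Lemma pow_mul_eq0 a b n : a ** b = 0 -> (a ** a) ** b = 0 -> pow a n ** b = 0.
Proof.
move=> ab0 aab0.
suff [] : pow a n ** b = 0 /\ pow a n.+1 ** b = 0 by [].
elim: n => [//|n [IHn IHn1]]; split=> //.
have -> : pow a n.+2 ** b = (a ** (a ** pow a n)) ** b by [].
by rewrite mul_mul2 IHn ab0 !mul0r scaler0 !subr0 addr0.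
Qed.

Lemma exists_pow_dependent a :
  exists k, pow a k \in <<mkseq (fun i => pow a i) k>>%VS.
Proof.
apply: contrapT => /forallNP indep.
have free_pow k : free (mkseq (fun i => pow a i) k).
  elim: k => [|k IHk]; first by rewrite nil_free.
  rewrite mkseqS (perm_free (Y := pow a k :: mkseq (fun i => pow a i) k)).
    by rewrite free_cons IHk andbT; apply/negP.
  by rewrite perm_rcons.
have := dimvS (subvf <<mkseq (fun i => pow a i) (\dim {:A}).+1>>%VS).
by rewrite (eqP (free_pow _)) size_mkseq ltnn.
Qed.

(** * Algebras without elements of square zero *)

Hypothesis reduced : forall a, a ** a = 0 -> a = 0.

Lemma reduced_no_nilpotent : no_nilpotent_elements mul.
Proof.
move=> a [//|n] _; rewrite /jpow /=; elim: n => [//|n IHn] an0.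
(* As [pow a n] is a^(n+1), its square a^(2n+2) arises from a^(n+2) = 0 by n further multiplications
   by [a]. *)
apply: IHn; apply: reduced; rewrite mul_pow.
have powD m k : pow a (m + k) = iter m (mul a) (pow a k) by rewrite iterD.
rewrite -addnS powD an0; elim: (n) => [//|m IHm].
by rewrite iterS IHm mul0r.
Qed.

(* The powers of [a] span a commutative associative algebra without nilpotents,
   on which multiplication by [a] is injective, hence onto: it has a unit. *)
Lemma exists_support a : exists e,
  [/\ e ** e = e, e ** a = a &
      forall b, a ** b = 0 -> (a ** a) ** b = 0 -> e ** b = 0].
Proof.
have [k ak] := exists_pow_dependent a.
set C := (<<_>>)%VS in ak.
have powC i : (i <= k)%N -> pow a i \in C.
  rewrite leq_eqVlt => /predU1P[-> //|lt_ik].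
  by apply: memv_span; apply/mapP; exists i; rewrite ?mem_iota.
have kerC (f : 'Hom(A, A)) c : (forall i, f (pow a i) = 0) -> c \in C -> f c = 0.
  move=> f0 Cc; apply/eqP; rewrite -memv_ker; apply: subvP Cc.
  by apply/span_subvP => _ /mapP[i _ ->]; rewrite memv_ker f0.
have commC c z : c \in C -> a ** (c ** z) = c ** (a ** z).
  pose f : 'Hom(A, A) := linfun (applyr mul (a ** z)) -
    (linfun (mul a) \o linfun (applyr mul z))%VF.
  have fE x : f x = x ** (a ** z) - a ** (x ** z).
    by rewrite /f add_lfunE opp_lfunE comp_lfunE !lfunE.
  move=> Cc; apply/esym/eqP; rewrite -subr_eq0 -fE; apply/eqP; apply: kerC Cc => i.
  by rewrite fE mul_powC subrr.
have stabC : (linfun (mul a) @: C <= C)%VS.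
  rewrite limg_span; apply/span_subvP => _ /mapP[_ /mapP[i ltik ->] ->].
  by rewrite lfunE; apply: (powC i.+1); rewrite mem_iota in ltik.
(* An element of [C] killed by [a] kills every power of [a], hence all of [C], hence itself. *)
have injC : (C :&: lker (linfun (mul a)) = 0)%VS.
  apply/eqP; rewrite -subv0; apply/subvP => c /memv_capP[Cc].
  rewrite memv_ker lfunE memv0 => /eqP ac0; apply/eqP; apply: reduced.
  rewrite -[LHS](lfunE (mul c)); apply: kerC (Cc) => i; rewrite lfunE /=.
  elim: i => [|i IHi] /=; first by rewrite mulC.
  by rewrite -commC // IHi mul0r.
have /memv_imgP[e Ce /esym] : a \in (linfun (mul a) @: C)%VS.
  suff /eqP -> : (linfun (mul a) @: C)%VS == C by apply: (powC 0).
  by rewrite eqEdim stabC (limg_dim_eq injC) leqnn.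
rewrite lfunE /= mulC => ea; exists e.
have unitC c : c \in C -> e ** c = c.
  move=> Cc; apply/eqP; rewrite -subr_eq0.
  pose f : 'Hom(A, A) := linfun (mul e) - \1%VF.
  have fE x : f x = e ** x - x.
    by rewrite add_lfunE opp_lfunE id_lfunE lfunE.
  rewrite -fE; apply/eqP; apply: kerC Cc => i; rewrite fE.
  elim: i => [|i IHi] /=; first by rewrite ea subrr.
  by rewrite -commC // -linearBr IHi mul0r.
split=> [||b ab0 aab0] //; first exact: unitC.
have <- : linfun (applyr mul b) e = e ** b by rewrite lfunE.
by apply: kerC Ce => i; rewrite lfunE; apply: pow_mul_eq0.
Qed.

Let U0r a : U a 0 = 0.
Proof. by rewrite UE !mul0r mul0l scaler0 subr0. Qed.

Lemma Uop_sqr_eq0 x b :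
  U x (b ** b) = 0 -> x ** b = 0 /\ (b ** b) ** x = 0.
Proof.
move=> Uxbb.
have Ubx : U b x = 0 by apply: reduced; rewrite sqr_Uop Uxbb U0r.
have Ubxx : U b (x ** x) = 0.
  by apply: reduced; rewrite sqr_Uop Uop_sqr Uxbb !U0r.
have xb : x ** b = 0.
  apply: reduced; apply/eqP; have := sqr_mul x b.
  rewrite Ubx Uxbb Ubxx mul0r scaler0 !addr0 => /eqP.
  by rewrite scaler_eq0 pnatr_eq0.
split=> //; move: Ubx.
by rewrite UE (mulC b x) xb mul0l scaler0 sub0r => /eqP; rewrite oppr_eq0 => /eqP.
Qed.

(** * Peirce spaces of an idempotent *)

Section Peirce.
Variable e : A.
Hypothesis ee : e ** e = e.

(** Multiplication by [e] is a root of t(2t-1)(t-1), so its only possible eigenvalues are 0, 1/2 and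
    1. *)
Lemma peirce_cubic z :
  2%:R *: (e ** (e ** (e ** z))) = 3%:R *: (e ** (e ** z)) - e ** z.
Proof. by move: (J e e z e); rewrite !ee; linear_combination. Qed.

Lemma peirce1_mul0 x y : e ** x = x -> e ** y = 0 -> x ** y = 0.
Proof.
move=> ex ey; move: (J e e y x) (J e e x y).
rewrite !ee (mulC y e) (mulC x e) ex ey; linear_combination.
Qed.

Lemma peirce0_mul x y : e ** x = 0 -> e ** y = 0 -> e ** (x ** y) = 0.
Proof.
move=> ex ey; move: (J e e y x).
rewrite !ee (mulC y e) (mulC x e) ex ey; linear_combination.
Qed.

Lemma peirce1_sqr x : e ** x = x -> e ** (x ** x) = x ** x.
Proof.
move=> ex; move: (J e e x x); rewrite !ee (mulC x e) ex; linear_combination.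
Qed.

(** The square of an element of the 1/2-space has no 1/2-component. *)
Lemma peirce_half_sqr x :
  2%:R *: (e ** x) = x -> e ** (e ** (x ** x)) = e ** (x ** x).
Proof.
move=> ex; have {}ex : e ** x = 2%:R^-1 *: x.
  by rewrite -[in RHS]ex scalerA mulVf ?scale1r // pnatr_eq0.
move: (J x x e e); rewrite !ee (mulC x e) ex !mulZl (mulC x e) ex.
linear_combination.
Qed.

(** [U e] is 2t^2-t evaluated at multiplication by [e]: the projection onto the 1-space. *)
Lemma mul_Uop z : e ** U e z = U e z.
Proof. by move: (peirce_cubic z); rewrite UE ee; linear_combination. Qed.

Lemma Uop_peirce1 z : e ** z = z -> U e z = z.
Proof. by move=> ez; rewrite UE ee ez mulC ez; linear_combination. Qed.

End Peirce.

(** * Annihilators as Peirce spaces *)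

Lemma exists_perp_idempotent b :
  exists2 r, r ** r = r & forall x, U x (b ** b) = 0 <-> r ** x = 0.
Proof.
have [r [rr rb supp]] := exists_support b; exists r => // x; split=> [Uxbb|rx].
  by have [xb bbx] := Uop_sqr_eq0 Uxbb; apply: supp; rewrite // mulC.
have rbb := peirce1_sqr rr rb.
rewrite UE (mulC x (b ** b)) (peirce1_mul0 rr rbb rx) mul0l scaler0 sub0r.
by rewrite mulC (peirce1_mul0 rr rbb (peirce0_mul rr rx rx)) oppr0.
Qed.

(* An idempotent [e] of the intersection [B] of the Peirce 0-spaces whose own
   Peirce 0-space has minimal dimension is the unit of [B]: a nonzero element of
   [B] orthogonal to [e] would have a support, which could be added to [e]. *)
Lemma exists_unit_peirce0 (I : set A) : (forall r, I r -> r ** r = r) ->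
  exists2 e, e ** e = e & forall x, (forall r, I r -> r ** x = 0) <-> e ** x = x.
Proof.
move=> idemI; pose B x := forall r, I r -> r ** x = 0.
have BD x y : B x -> B y -> B (x + y).
  by move=> Bx By r Ir; rewrite mulDr Bx ?By ?addr0.
have BZ k x : B x -> B (k *: x) by move=> Bx r Ir; rewrite mulZr Bx ?scaler0.
have BN x : B x -> B (- x) by rewrite -scaleN1r; apply: BZ.
have BM x y : B x -> B y -> B (x ** y).
  by move=> Bx By r Ir; exact (peirce0_mul (idemI r Ir) (Bx r Ir) (By r Ir)).
pose peirce0 e := lker (linfun (mul e)).
have peirce0P e x : (x \in peirce0 e) = (e ** x == 0) by rewrite memv_ker lfunE.
have [e [ee Be e0]] : exists e, [/\ e ** e = e, B e &
    forall x, B x -> e ** x = 0 -> x = 0].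
  suff enlarge n : forall e, e ** e = e -> B e -> (\dim (peirce0 e) < n)%N ->
      exists e, [/\ e ** e = e, B e & forall x, B x -> e ** x = 0 -> x = 0].
    apply: (enlarge _ 0); [exact: mul0l | | exact: ltnSn].
    by move=> r _; rewrite mul0r.
  elim: n => [//|n IHn] e ee Be lt_n.
  have [e0|] := pselect (forall x, B x -> e ** x = 0 -> x = 0); first by exists e.
  move=> /existsNP[a /not_implyP[Ba /not_implyP[ea a0]]].
  have [r [rr ra supp]] := exists_support a.
  have re : r ** e = 0 by apply: supp; rewrite mulC // peirce0_mul.
  have er : e ** r = 0 by rewrite mulC.
  have idem : (e + r) ** (e + r) = e + r.
    by rewrite mulDl !mulDr ee rr er re addr0 add0r.
  apply: (IHn (e + r)) => //.
    apply: BD => // s Is; rewrite mulC.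
    by apply: supp; rewrite mulC; [apply: Ba|apply: (BM a a)].
  rewrite -ltnS; apply: leq_trans lt_n; rewrite ltnS ltn_neqAle.
  have sub : (peirce0 (e + r)%R <= peirce0 e)%VS.
    apply/subvP => x; rewrite !peirce0P => /eqP x0; apply/eqP.
    by apply: (peirce1_mul0 idem) => //; rewrite mulDl ee re addr0.
  (* The inclusion is strict: [r] is in the 0-space of [e], but in that of [e + r] only if [r = 0],
     which forces [a = r ** a = 0]. *)
  rewrite (dimvS sub) andbT (dimv_leqif_sup sub); apply/negP => /subvP/(_ r).
  rewrite !peirce0P mulDl er rr add0r eqxx => /(_ isT)/eqP r0.
  by apply: a0; rewrite -ra r0 mul0l.
exists e => // x; split=> [Bx|ex r Ir]; last first.
  by rewrite mulC; apply: (peirce1_mul0 ee ex); rewrite mulC Be.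
have Bex y : B y -> B (e ** y) by apply: BM.
(* As [e] kills nothing nonzero in [B], the cubic puts [y] in the 1/2-space and [y ** y] in the
   1-space. Then [U y e], equal to [y ** y - e ** (y ** y)], vanishes, which forces [y ** e = 0]. *)
pose y := e ** x - x.
have By : B y by apply: BD; [apply: Bex|apply: BN].
have ey : 2%:R *: (e ** y) = y.
  apply/eqP; rewrite -subr_eq0; apply/eqP; apply: e0.
    by apply: BD; [apply: BZ; apply: Bex|apply: BN].
  by rewrite /y; move: (peirce_cubic ee x); linear_combination.
have yye : y ** y - e ** (y ** y) = 0.
  apply: e0; first by apply: BD; [apply: BM|apply: BN; apply: Bex; apply: BM].
  by rewrite linearBr peirce_half_sqr // subrr.
have Uye : U y (e ** e) = 0.
  rewrite UE ee (mulC y e) -mulZl ey mulC.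
  by rewrite (mulC e) in yye; rewrite -[RHS]yye; congr (_ - _); rewrite mulC.
have [ye _] := Uop_sqr_eq0 Uye.
have : y = 0 by rewrite -ey mulC ye scaler0.
by move/eqP; rewrite subr_eq0 => /eqP.
Qed.

Lemma reduced_is_baer : is_baer_jordan mul.
Proof.
split=> // S sqS.
(* Taking all such [r] avoids choosing one for each [s]. *)
pose I r := r ** r = r /\ exists2 s, S s & forall x, U x s = 0 <-> r ** x = 0.
have [e ee eP] := exists_unit_peirce0 (I := I) (fun r => @proj1 _ _).
exists e => //; apply/seteqP; split=> x /=.
  move=> Sx; exists x => //; apply: Uop_peirce1 => //; apply/eP => r [rr [s Ss rP]].
  by apply/rP/Sx.
case=> z _ <- s Ss; have [b _ bb] := sqS s Ss.
have [r rr rP] := exists_perp_idempotent b.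
rewrite -bb; apply/rP; move/eP: (mul_Uop ee z); apply; split=> //.
by exists s => //; rewrite -bb.
Qed.

End Jordan.

(** * From the Baer condition to the absence of nilpotents *)

Lemma baer_reduced (F : realFieldType) (A : vectType F)
    (mul : {bilinear A -> A -> A}) (u : A) :
  is_identity mul u -> is_baer_jordan mul ->
  forall a, mul a a = 0 -> a = 0.
Proof.
move=> unit_u [jordan baer] a aa.
have [//|e ee perp_u] := baer [set u]%classic.
  by move=> _ ->; exists u => //; have [] := unit_u u.
have Uu x : Uop mul x u = mul x x.
  have [[ux xu] [_ xxu]] := (unit_u x, unit_u (mul x x)).
  by rewrite /Uop xu xxu scaler_nat mulr2n addrK.
have perpP x : mul x x = 0 <-> range (Uop mul e) x.
  by rewrite -perp_u; split=> [xx _ ->|/(_ u erefl)]; rewrite Uu.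
have e0 : e = 0.
  rewrite -ee; apply/perpP; exists e => //.
  by rewrite /Uop !ee scaler_nat mulr2n addrK.
have [z _ <-] : range (Uop mul e) a by apply/perpP.
by rewrite /Uop e0 !linear0l scaler0 subr0.
Qed.

Theorem theorem3p7 (R : realType) (A : vectType R)
    (mul : {bilinear A -> A -> A}%R) (u : A) :
  is_jordan mul -> is_identity mul u ->
  no_nilpotent_elements mul <-> is_baer_jordan mul.
Proof.
move=> jordan unit_u; split=> [nonil|baer].
  by apply: reduced_is_baer => // a aa; apply: (nonil a 2).
by apply: reduced_no_nilpotent => //; apply: baer_reduced baer.
Qed.
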